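(* Let $p,q$ be complex constants and let $(a_n^k)_{n,k\ge0}$ be complex numbers satisfying $$a_n^k=p\,k\,a_n^{k-1}+q\,k\,a_{n+1}^{k-1}\qquad(n\ge0,\ k\ge1).$$ Then, as formal power series, $$\bar A(t)=\frac{1}{1-pt}\;a\!\left(\frac{qt}{1-pt}\right).$$
   Context: Superscripts in $a_n^k$ are indices, not powers. The initial sequence $(a_n^0)_{n\ge0}$ is arbitrary. $a(t)=\sum_{n\ge0}a_n^0t^n$ is the ordinary generating function of the initial sequence and $\bar A(t)=\sum_{n\ge0}a_0^n\frac{t^n}{n!}$ is the exponential generating function of the final sequence $(a_0^n)_{n\ge0}$. *)

(* Defs.v *)
From HB Require Import structures.
From mathcomp Require Import all_boot all_order all_algebra.
From mathcomp Require Import boolp reals.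
From mathcomp Require Export complex.

Set Implicit Arguments.
Unset Strict Implicit.
Unset Printing Implicit Defensive.

Import GRing.Theory.
Local Open Scope ring_scope.

(* Formal power series over R. A wrapper record is used instead of a bare
   [nat -> R], on which the canonical product is the pointwise one. *)
Record fps (R : Type) := FPS { fps_coef : nat -> R }.

HB.instance Definition _ (R : Type) := gen_eqMixin (fps R).
HB.instance Definition _ (R : Type) := gen_choiceMixin (fps R).

Lemma fpsP (R : Type) (f g : fps R) : fps_coef f =1 fps_coef g <-> f = g.
Proof.
by split=> [|-> //]; case: f g => [f] [g] /= fg; congr FPS; apply/funext.
Qed.

Section FpsRing.
Variable R : comNzRingType.
Implicit Types (f g h : fps R) (c : R).

Definition fps_zero : fps R := FPS (fun=> 0).
Definition fps_opp f : fps R := FPS (fun n => - fps_coef f n).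
Definition fps_add f g : fps R := FPS (fun n => fps_coef f n + fps_coef g n).
Definition fps_one : fps R := FPS (fun n => (n == 0)%:R).
Definition fps_mul f g : fps R :=
  FPS (fun n => \sum_(i < n.+1) fps_coef f i * fps_coef g (n - i)).
Definition fps_scale c f : fps R := FPS (fun n => c * fps_coef f n).

Fact fps_addA : associative fps_add.
Proof. by move=> f g h; apply/fpsP => n /=; rewrite addrA. Qed.
Fact fps_addC : commutative fps_add.
Proof. by move=> f g; apply/fpsP => n /=; rewrite addrC. Qed.
Fact fps_add0 : left_id fps_zero fps_add.
Proof. by move=> f; apply/fpsP => n /=; rewrite add0r. Qed.
Fact fps_addN : left_inverse fps_zero fps_opp fps_add.
Proof. by move=> f; apply/fpsP => n /=; rewrite addNr. Qed.

HB.instance Definition _ :=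
  GRing.isZmodule.Build (fps R) fps_addA fps_addC fps_add0 fps_addN.

Let tr n f : {poly R} := \poly_(i < n.+1) fps_coef f i.

Let trE n m f : (m <= n)%N -> (tr n f)`_m = fps_coef f m.
Proof. by move=> mn; rewrite coef_poly ltnS mn. Qed.

Let mul_tr n m f g :
  (m <= n)%N -> fps_coef (fps_mul f g) m = (tr n f * tr n g)`_m.
Proof.
move=> mn; rewrite coefM; apply: eq_bigr => i _; rewrite !trE //.
  exact: leq_trans (leq_subr _ _) mn.
by rewrite (leq_trans _ mn) // -ltnS.
Qed.

Fact fps_mulC : commutative fps_mul.
Proof. by move=> f g; apply/fpsP => n; rewrite !(mul_tr _ _ (leqnn n)) mulrC. Qed.
Fact fps_mulA : associative fps_mul.
Proof.
move=> f g h; apply/fpsP => n.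
rewrite (mul_tr f _ (leqnn n)) (mul_tr _ h (leqnn n)).
have -> : (tr n f * tr n (fps_mul g h))`_n = (tr n f * (tr n g * tr n h))`_n.
  rewrite !(coefM (tr n f)); apply: eq_bigr => i _; congr (_ * _).
  by rewrite trE ?leq_subr // (mul_tr _ _ (leq_subr i n)).
rewrite mulrA [LHS]coefM [RHS]coefM; apply: eq_bigr => i _; congr (_ * _).
have le_in : (i <= n)%N by rewrite -ltnS.
by rewrite (trE (fps_mul f g) le_in) (mul_tr f g le_in).
Qed.
Fact fps_mul1 : left_id fps_one fps_mul.
Proof.
move=> f; apply/fpsP => n /=; rewrite big_ord_recl /= mul1r subn0 big1 ?addr0//.
by move=> i _; rewrite mul0r.
Qed.
Fact fps_mulDl : left_distributive fps_mul +%R.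
Proof.
move=> f g h; apply/fpsP => n /=; rewrite -big_split /=.
by apply: eq_bigr => i _; rewrite mulrDl.
Qed.
Fact fps_one_neq0 : fps_one != 0.
Proof. by apply/eqP => /fpsP /(_ 0) /eqP; rewrite /= oner_eq0. Qed.

HB.instance Definition _ := GRing.Zmodule_isComNzRing.Build (fps R)
  fps_mulA fps_mulC fps_mul1 fps_mulDl fps_one_neq0.

Fact fps_scaleA c d f : fps_scale c (fps_scale d f) = fps_scale (c * d) f.
Proof. by apply/fpsP => n /=; rewrite mulrA. Qed.
Fact fps_scale1 : left_id 1 fps_scale.
Proof. by move=> f; apply/fpsP => n /=; rewrite mul1r. Qed.
Fact fps_scaleDr : right_distributive fps_scale +%R.
Proof. by move=> c f g; apply/fpsP => n /=; rewrite mulrDr. Qed.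
Fact fps_scaleDl f : {morph fps_scale^~ f : c d / c + d}.
Proof. by move=> c d; apply/fpsP => n /=; rewrite mulrDl. Qed.

HB.instance Definition _ := GRing.Zmodule_isLmodule.Build R (fps R)
  fps_scaleA fps_scale1 fps_scaleDr fps_scaleDl.

Lemma fps_coef0 n : fps_coef (0 : fps R) n = 0.
Proof. by []. Qed.
Lemma fps_coef1 n : fps_coef (1 : fps R) n = (n == 0)%:R.
Proof. by []. Qed.
Lemma fps_coefD f g n : fps_coef (f + g) n = fps_coef f n + fps_coef g n.
Proof. by []. Qed.
Lemma fps_coefN f n : fps_coef (- f) n = - fps_coef f n.
Proof. by []. Qed.
Lemma fps_coefB f g n : fps_coef (f - g) n = fps_coef f n - fps_coef g n.
Proof. by []. Qed.
Lemma fps_coefZ c f n : fps_coef (c *: f) n = c * fps_coef f n.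
Proof. by []. Qed.
Lemma fps_coefM f g n :
  fps_coef (f * g) n = \sum_(i < n.+1) fps_coef f i * fps_coef g (n - i).
Proof. by []. Qed.

Lemma fps_coef_sum (I : Type) (r : seq I) (P : pred I) (F : I -> fps R) n :
  fps_coef (\sum_(i <- r | P i) F i) n = \sum_(i <- r | P i) fps_coef (F i) n.
Proof. by elim/big_rec2: _ => // i x y _ <-. Qed.

Lemma fps_scaleAl c f g : c *: (f * g) = (c *: f) * g.
Proof.
apply/fpsP => n; rewrite fps_coefZ !fps_coefM mulr_sumr.
by apply: eq_bigr => i _; rewrite fps_coefZ mulrA.
Qed.

HB.instance Definition _ :=
  GRing.Lmodule_isLalgebra.Build R (fps R) fps_scaleAl.
HB.instance Definition _ := GRing.Lalgebra_isComAlgebra.Build R (fps R).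

Definition fps_X : fps R := FPS (fun n => (n == 1)%:R).

(* Composition f(g(t)). It is meaningful when g has zero constant term: then
   g ^+ k has no term of degree below k, so that the coefficient of t^n in the
   formal sum of the f_k g(t)^k only involves the indices k <= n
   (see [fps_comp_coef_widen]). *)
Definition fps_comp f g : fps R :=
  FPS (fun n => \sum_(k < n.+1) fps_coef f k * fps_coef (g ^+ k) n).

Lemma fps_expr_low g k n :
  fps_coef g 0 = 0 -> (n < k)%N -> fps_coef (g ^+ k) n = 0.
Proof.
move=> g0; elim: k n => [//|k IH] n nk; rewrite exprS fps_coefM big_ord_recl.
rewrite g0 mul0r add0r big1 // => i _; rewrite IH ?mulr0 //=.
by rewrite /bump /= add1n; case: n nk i => [_ [] //|n] nk i;
   rewrite subSS (leq_ltn_trans (leq_subr _ _)).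
Qed.

Lemma fps_comp_coef_widen f g n m : fps_coef g 0 = 0 -> (n < m)%N ->
  fps_coef (fps_comp f g) n = \sum_(k < m) fps_coef f k * fps_coef (g ^+ k) n.
Proof.
move=> g0 nm /=; rewrite (big_ord_widen _ (fun k => fps_coef f k *
  fps_coef (g ^+ k) n) nm) big_mkcond /=; apply: eq_bigr => k _.
by case: ltnP => // nk; rewrite fps_expr_low ?mulr0.
Qed.

End FpsRing.

Section FpsInverse.
Variable R : comUnitRingType.
Implicit Types f g : fps R.

Definition fps_unit : {pred fps R} := fun f => fps_coef f 0 \is a GRing.unit.

(* If f = c (1 - g) with c invertible and g(0) = 0, then
   1 / f = c^-1 (1 + g + g^2 + ...). *)
Definition fps_inv f : fps R :=
  let c := fps_coef f 0 in
  if f \in fps_unit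
  then c^-1 *: fps_comp (FPS (fun=> 1)) (1 - c^-1 *: f)
  else f.

Fact fps_mulV : {in fps_unit, left_inverse 1 fps_inv *%R}.
Proof.
move=> f fu; rewrite /fps_inv fu; set c := fps_coef f 0.
have cu : c \is a GRing.unit by [].
pose g := 1 - c^-1 *: f; rewrite -/g.
have g0 : fps_coef g 0 = 0.
  by rewrite fps_coefB fps_coef1 fps_coefZ mulVr ?subrr.
have -> : f = c *: (1 - g) by rewrite /g subKr scalerA mulrV ?scale1r.
rewrite -scalerAl -scalerAr scalerA mulVr // scale1r.
apply/fpsP => n; pose s : fps R := \sum_(k < n.+1) g ^+ k.
transitivity (fps_coef (s * (1 - g)) n).
  rewrite !fps_coefM; apply: eq_bigr => i _; congr (_ * _).
  rewrite (fps_comp_coef_widen _ g0 (ltn_ord i)) fps_coef_sum.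
  by apply: eq_bigr => k _; rewrite mul1r.
rewrite mulrC /s -opprB mulNr -subrX1 opprB fps_coefB.
by rewrite (fps_expr_low g0 (ltnSn n)) subr0.
Qed.

Fact fps_unitPl f g : g * f = 1 -> fps_unit f.
Proof.
move=> /fpsP /(_ 0); rewrite fps_coefM big_ord1 subnn fps_coef1 /= => gf.
by apply/unitrPr; exists (fps_coef g 0); rewrite mulrC.
Qed.

Fact fps_inv_out : {in [predC fps_unit], fps_inv =1 id}.
Proof. by move=> f /negbTE nu; rewrite /fps_inv [f \in _]nu. Qed.

HB.instance Definition _ := GRing.ComNzRing_hasMulInverse.Build (fps R)
  fps_mulV fps_unitPl fps_inv_out.

Lemma fps_unitE f : (f \is a GRing.unit) = (fps_coef f 0 \is a GRing.unit).
Proof. by []. Qed.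

End FpsInverse.

Definition ogf (R : Type) (u : nat -> R) : fps R := FPS u.

Definition egf (R : unitRingType) (u : nat -> R) : fps R :=
  FPS (fun n => u n / n`!%:R).

(* Main.v *)
Require Import Defs.
From mathcomp Require Import all_boot all_order all_algebra.
From mathcomp Require Import reals complex.

Import GRing.Theory.
Local Open Scope ring_scope.

(* Let F_n be the exponential generating function of (a_n^k)_k.  The recurrence
   says F_n = a_n^0 + p t F_n + q t F_(n+1), that is F_n = a_n^0 u + g F_(n+1)
   with u = 1/(1 - p t) and g = q t u.  Iterating,
   F_0 = u (a_0^0 + a_1^0 g + ... + a_(m-1)^0 g^(m-1)) + g^m F_m,
   and g^m has no term of degree below m. *)

Lemma fps_coefXM (R : comNzRingType) (f : fps R) n :
  fps_coef (fps_X R * f) n = if n is m.+1 then fps_coef f m else 0.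
Proof.
rewrite fps_coefM big_ord_recl /= mul0r add0r.
case: n => [|n]; first by rewrite big_ord0.
rewrite big_ord_recl /= mul1r subSS subn0 big1 ?addr0 // => i _.
by rewrite mul0r.
Qed.

Lemma fps_coef_mul_low (R : comNzRingType) (f h : fps R) n :
  (forall i, (i <= n)%N -> fps_coef f i = 0) -> fps_coef (f * h) n = 0.
Proof.
by move=> f0; rewrite fps_coefM big1 // => i _; rewrite f0 ?mul0r // -ltnS.
Qed.

(** The product only sees degrees [n - i <= n] of the composition, and one truncation at [k <= n]
    serves all of them. A finite sum of powers is what the unrolling below produces. *)
Lemma fps_coef_mul_comp (R : comNzRingType) (u f g : fps R) n :
  fps_coef g 0 = 0 ->
  fps_coef (u * fps_comp f g) n =
  fps_coef (u * \sum_(k < n.+1) fps_coef f k *: g ^+ k) n.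
Proof.
move=> g0; rewrite !fps_coefM; apply: eq_bigr => i _; congr (_ * _).
rewrite (fps_comp_coef_widen _ g0 (leq_subr i n : (n - i < n.+1)%N)).
by rewrite fps_coef_sum.
Qed.

Lemma fps_comp_unroll (R : comNzRingType) (u g : fps R) (b : nat -> R)
    (F : nat -> fps R) :
  fps_coef g 0 = 0 -> (forall n, F n = b n *: u + g * F n.+1) ->
  F 0%N = u * fps_comp (ogf b) g.
Proof.
move=> g0 FE.
have unroll m : F 0%N = u * (\sum_(k < m) b k *: g ^+ k) + g ^+ m * F m.
  elim: m => [|m IH]; first by rewrite big_ord0 mulr0 add0r mul1r.
  rewrite {}IH FE big_ord_recr /= !mulrDr addrA mulrA -exprSr.
  by rewrite -!scalerAr [g ^+ m * u]mulrC.
(* Unrolling [n.+1] times suffices: the remainder starts in degree [n.+1]. *)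
apply/fpsP => n; rewrite fps_coef_mul_comp // (unroll n.+1) fps_coefD.
rewrite [X in _ + X]fps_coef_mul_low ?addr0 // => i le_in.
by rewrite fps_expr_low.
Qed.

(** The factor [k.+1] turns [1/(k.+1)!] into [1/k!], so lowering the superscript by one becomes
    multiplication by [fps_X]. The scalar term is the coefficient at [k = 0]. *)
Lemma egf_recurrence (K : numFieldType) (p q : K) (a : nat -> nat -> K) n :
  (forall k, a n k.+1 = p * k.+1%:R * a n k + q * k.+1%:R * a n.+1 k) ->
  egf (a n) = (a n 0%N)%:A + p *: (fps_X K * egf (a n))
              + q *: (fps_X K * egf (a n.+1)).
Proof.
move=> aS; apply/fpsP => -[|k]; rewrite !fps_coefD !fps_coefZ !fps_coefXM /=.
  by rewrite fact0 divr1 !mulr0 !addr0 mulr1.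
have k1 : k.+1%:R != 0 :> K by rewrite Num.Theory.pnatr_eq0.
rewrite mulr0 add0r aS factS natrM invfM !mulrDl.
by congr (_ + _); rewrite -!mulrA; congr (_ * _); rewrite mulrCA mulVKf.
Qed.

(* [a n k] is the entry with subscript n and superscript k. *)
Theorem theorem19 (R : realType) (p q : R[i]) (a : nat -> nat -> R[i])
  (ha : forall n k : nat, (1 <= k)%N ->
     a n k = p * k%:R * a n k.-1 + q * k%:R * a n.+1 k.-1) :
  egf (fun n => a 0%N n) =
    (1 - p *: fps_X R[i])^-1 *
    fps_comp (ogf (fun n => a n 0%N))
             ((q *: fps_X R[i]) / (1 - p *: fps_X R[i])).
Proof.
set d := 1 - p *: fps_X _.
have du : d \is a GRing.unit.
  by rewrite fps_unitE fps_coefB fps_coefZ fps_coef1 /= mulr0 subr0 unitr1.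
apply: (@fps_comp_unroll _ _ _ _ (fun n => egf (a n))) => [|n].
  by rewrite -scalerAl fps_coefZ fps_coefXM mulr0.
(* Multiplying by [d] clears the inverses; moving the [p] term to the right then leaves
   [egf_recurrence]. *)
apply: (mulrI du); rewrite mulrDr -scalerAr mulrV //.
rewrite mulrA [d * (_ / d)]mulrC divrK // -scalerAl.
rewrite mulrBl mul1r -scalerAl.
apply/eqP; rewrite subr_eq addrAC; apply/eqP.
by apply: egf_recurrence => k; apply: ha.
Qed.
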